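(* Consider the controlled $N$-particle systems, their finite-horizon values and the deterministic limit system described in the context, and assume: (A1) given the context value $C$ and the action $a$ at time $t$, the particles move independently of each other, each according to the Markov kernel $K(a,C)$; (A2) the action set $\mathcal{A}$ is compact; (A3) the maps $(C,a)\mapsto K(a,C)$, $(C,M,a)\mapsto g(C,M,a)$ and $(M,C)\mapsto r_t(M,C)$ are continuous deterministic functions, uniformly continuous in $a$; (A4) almost surely $(M^N_0,C^N_0)$ converges to a deterministic value $(m_0,c_0)$ as $N\to\infty$, and there is $B<\infty$ such that almost surely $\|C^N_0\|_\infty\le B$ for all $N$. Let $a^*_0,\dots,a^*_{T-1}$ be a sequence of actions with $v_{a^*_0\dots a^*_{T-1}}(m_0,c_0)=v^*_T(m_0,c_0)$ (the sequence of optimal limit actions). Then, almost surely, $$\lim_{N\to\infty}V^{*N}_T(M^N_0,C^N_0)=\lim_{N\to\infty}V^{N}_{a^*_0\dots a^*_{T-1}}(M^N_0,C^N_0)=v^*_T(m_0,c_0).$$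
   Context: Model. Fix $S,d,T\ge 1$, $\mathcal{S}=\{1,\dots,S\}$, $\mathcal{P}(\mathcal{S})$ the set of probability measures on $\mathcal{S}$ (a subset of $\mathbb{R}^S$), and $\mathcal{P}_N(\mathcal{S})$ the set of $p\in\mathcal{P}(\mathcal{S})$ with $Np(i)\in\mathbb{N}$ for all $i$. The action set $\mathcal{A}$ is a metric space. For $a\in\mathcal{A}$, $C\in\mathbb{R}^d$, $K(a,C)=(K_{i,j}(a,C))_{i,j\in\mathcal{S}}$ is a stochastic matrix; $g:\mathbb{R}^d\times\mathcal{P}(\mathcal{S})\times\mathcal{A}\to\mathbb{R}^d$; and $r_t:\mathcal{P}(\mathcal{S})\times\mathbb{R}^d\to\mathbb{R}$ are reward functions. None of these depends on $N$. For each $N$ there are $N$ particles with states $X^N_n(t)\in\mathcal{S}$; $(M^N_t)_i=\frac1N\sum_{n=1}^N\mathbf 1_{X^N_n(t)=i}$, so $M^N_t\in\mathcal{P}_N(\mathcal{S})$. If action $a_t$ is used at time $t$, each particle in state $i$ moves to state $j$ with probability $K_{i,j}(a_t,C^N_t)$, and then $C^N_{t+1}=g(C^N_t,M^N_{t+1},a_t)\in\mathbb{R}^d$. The initial states $(M_0^N,C_0^N)$, $N\ge1$, may be random and are defined on a common probability space; $\|C\|_\infty=\sup_i|C_i|$. Values. A policy $\Pi=(\Pi_0,\dots,\Pi_{T-1})$ is a sequence of (measurable) maps $\Pi_t:\mathcal{P}_N(\mathcal{S})\times\mathbb{R}^d\to\mathcal{A}$; under it the action at time $t$ is $\Pi_t(M^N_t,C^N_t)$.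 For an initial state $(M,C)$, $V^N_{\Pi}(M,C)=\mathbb{E}\big[\sum_{t=1}^{T}r_t(M^N_t,C^N_t)\big]$, the expectation being for the system started at $(M,C)$ under $\Pi$; $V^N_{a_0\dots a_{T-1}}$ is the value of the policy using the fixed action $a_t$ at time $t$; $V^{*N}_T(M,C)=\sup_\Pi V^N_\Pi(M,C)$. These functions evaluated at the random initial state $(M^N_0,C^N_0)$ are random variables. Deterministic limit. $\Phi_a(m,c)=(m',c')$ with $m'=mK(a,c)$ and $c'=g(c,m',a)$; $\Phi_{a_0\dots a_{t-1}}$ denotes applying $\Phi_{a_0}$, then $\Phi_{a_1}$, ..., then $\Phi_{a_{t-1}}$. Put $v_{a_0\dots a_{T-1}}(m_0,c_0)=\sum_{t=1}^{T}r_t(\Phi_{a_0\dots a_{t-1}}(m_0,c_0))$ and $v^*_T(m_0,c_0)=\sup_{a_0,\dots,a_{T-1}\in\mathcal{A}}v_{a_0\dots a_{T-1}}(m_0,c_0)$ (the supremum is attained when $\mathcal{A}$ is compact). *)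

(* Defs.v *)
From HB Require Import structures.
From mathcomp Require Import all_boot all_order all_algebra.
From mathcomp Require Import perm.
From mathcomp Require Import all_classical all_reals all_analysis.

Set Implicit Arguments.
Unset Strict Implicit.
Unset Printing Implicit Defensive.

Import Order.TTheory GRing.Theory Num.Theory.
Import numFieldTopology.Exports.

Local Open Scope classical_set_scope.
Local Open Scope ring_scope.

Section Distributions.
Context {R : realType} {S : nat}.

Definition distributions : set 'rV[R]_S :=
  [set p | (forall i, 0 <= p ord0 i) /\ \sum_i p ord0 i = 1].

Definition grid_distributions (N : nat) : set 'rV[R]_S :=
  [set p | distributions p /\
           forall i, exists k : nat, N%:R * p ord0 i = k%:R].

(* A system indexed by N has N.+1 particles: this rules out the empty system
   and is immaterial for limits as N tends to infinity. *)
Definition config (N : nat) := {ffun 'I_N.+1 -> 'I_S}.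

Definition empirical N (x : config N) : 'rV[R]_S :=
  \row_i (N.+1%:R^-1 * \sum_(n < N.+1) (x n == i)%:R).

Definition stochastic_matrix (k : 'M[R]_S) : Prop :=
  (forall i j, 0 <= k i j) /\ (forall i, \sum_j k i j = 1).

End Distributions.

(* Measurability for the Borel sigma-algebras, relatively to the domain D. *)
Definition borel_fun_on {X Y : topologicalType} (D : set X) (f : X -> Y) : Prop :=
  forall U : set Y, <<s open >> U -> <<s open >> (D `&` f @^-1` U).

(* The maps next_context and mf_reward are only meaningful when their argument in
   'rV_S lies in distributions; nothing is assumed on them elsewhere. *)
Record model (R : realType) (S d : nat) (A : metricType R) := Model {
  transition_matrix : A -> 'rV[R]_d -> 'M[R]_S ;
  next_context : 'rV[R]_d -> 'rV[R]_S -> A -> 'rV[R]_d ;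
  mf_reward : nat -> 'rV[R]_S -> 'rV[R]_d -> R ;
  transition_matrix_stochastic : forall a C, stochastic_matrix (transition_matrix a C) }.

Section ControlledSystem.
Context {R : realType} {S d : nat} {A : metricType R}.
Variables (m : model S d A) (T : nat).

Local Notation state := ('rV[R]_S * 'rV[R]_d)%type.

(* Sequences of actions and policies are indexed by nat; only their entries
   of index t < T are ever used. *)

Definition limit_step (a : A) (s : state) : state :=
  let M' := s.1 *m transition_matrix m a s.2 in (M', next_context m s.2 M' a).

Fixpoint limit_flow (a : nat -> A) (s : state) (t : nat) : state :=
  if t is u.+1 then limit_step (a u) (limit_flow a s u) else s.

Definition limit_value (a : nat -> A) (s : state) : R :=
  \sum_(1 <= t < T.+1) mf_reward m t (limit_flow a s t).1 (limit_flow a s t).2.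

Definition limit_opt_value (s : state) : \bar R :=
  ereal_sup [set (limit_value a s)%:E | a in [set: nat -> A]].

Definition policy : Type := nat -> state -> A.

Definition admissible (N : nat) (Pi : policy) : Prop :=
  forall t, (t < T)%N ->
    borel_fun_on (grid_distributions N.+1 `*` [set: 'rV[R]_d]) (Pi t).

Definition constant_policy (a : nat -> A) : policy := fun t _ => a t.

Section Trajectory.
Variables (N : nat) (Pi : policy) (C : 'rV[R]_d) (X : nat -> @config S N).

(* Context and action at time t when the particles follow X. *)
Fixpoint context_at (t : nat) : 'rV[R]_d :=
  if t is u.+1 then
    next_context m (context_at u) (empirical (X u.+1))
      (Pi u (empirical (X u), context_at u))
  else C.

Definition action_at (t : nat) : A := Pi t (empirical (X t), context_at t).

Definition total_reward : R :=
  \sum_(1 <= t < T.+1) mf_reward m t (empirical (X t)) (context_at t).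

End Trajectory.

(* Given the context and the action, the particles move independently, each
   according to the kernel: the joint transition probability is a product. *)
Definition transition_prob N (a : A) (C : 'rV[R]_d) (x y : @config S N) : R :=
  \prod_(n < N.+1) transition_matrix m a C (x n) (y n).

Definition trajectory N := {ffun 'I_T.+1 -> @config S N}.

Definition position N (w : trajectory N) (t : nat) : config N := w (inord t).

(* Law of the trajectory of the particles, started at (x, C) under Pi. *)
Definition trajectory_prob N (Pi : policy) (x : config N) (C : 'rV[R]_d)
    (w : trajectory N) : R :=
  (position w 0 == x)%:R *
  \prod_(t < T) transition_prob (action_at Pi C (position w) t)
                  (context_at Pi C (position w) t)
                  (position w t) (position w t.+1).

Definition config_value N (Pi : policy) (x : config N) (C : 'rV[R]_d) : R :=
  \sum_(w : trajectory N)
    trajectory_prob Pi x C w * total_reward Pi C (position w).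

(* The particles are started in any configuration with empirical measure s.1;
   by config_value_empirical the choice is irrelevant, and one exists for
   s.1 in grid_distributions N.+1 by grid_distributionsP. *)
Definition value (N : nat) (Pi : policy) (s : state) : R :=
  if [pick x : config N | empirical x == s.1] is Some x
  then config_value Pi x s.2 else 0.

Definition opt_value (N : nat) (s : state) : \bar R :=
  ereal_sup [set (value N Pi s)%:E | Pi in admissible N].

Lemma empirical_grid N (x : @config S N) :
  grid_distributions N.+1 (@empirical R S N x).
Proof.
have sumE i : N.+1%:R * (@empirical R S N x) ord0 i
    = (\sum_(n < N.+1) (x n == i))%N%:R.
  by rewrite mxE mulrA divff ?mul1r ?pnatr_eq0// natr_sum.
split; last by move=> i; exists (\sum_(n < N.+1) (x n == i))%N.
split=> [i|].
  by rewrite mxE mulr_ge0 ?invr_ge0 ?sumr_ge0.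
under eq_bigr do rewrite mxE.
rewrite -mulr_sumr exchange_big /= (eq_bigr (fun=> 1)) => [|n _].
  by rewrite sumr_const card_ord mulVf ?pnatr_eq0.
rewrite (bigD1 (x n)) //= eqxx big1 ?addr0 // => i.
by rewrite eq_sym => /negbTE ->.
Qed.

Lemma grid_distributionsP N (M : 'rV[R]_S) :
  grid_distributions N.+1 M -> exists x : config N, empirical x = M.
Proof.
move=> [[M0 M1] /choice[k kE]].
pose s := flatten [seq nseq (k i) i | i <- enum 'I_S].
have sizes : size s = N.+1.
  rewrite size_flatten /shape -map_comp sumnE big_map big_enum /=.
  apply/eqP; rewrite -(eqr_nat R) natr_sum.
  under eq_bigr do rewrite size_nseq -kE.
  by rewrite -mulr_sumr M1 mulr1.
exists [ffun n => tnth (Tuple (introT eqP sizes)) n].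
apply/rowP => i; rewrite mxE.
apply: (@mulfI _ N.+1%:R); first by rewrite pnatr_eq0.
rewrite mulrA divff ?pnatr_eq0 // mul1r kE.
under eq_bigr do rewrite ffunE.
rewrite -(big_tuple _ _ (Tuple (introT eqP sizes)) xpredT
  (fun j => (j == i)%:R : R)) /=.
rewrite -natr_sum; congr (_%:R); rewrite /s.
rewrite big_flatten big_map big_enum /=.
rewrite (bigD1 i) //= big_nseq eqxx iter_addn_0 mul1n big1 ?addn0 // => j.
by move=> /negbTE ji; rewrite big_nseq ji iter_addn_0 mul0n.
Qed.

Section Relabelling.
Variables (N : nat) (p : 'S_N.+1).
Let relabel (x : @config S N) : config N := [ffun n => x (p n)].

Let empirical_relabel (x : @config S N) :
  empirical (relabel x) = empirical x :> 'rV[R]_S.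
Proof.
apply/rowP => i; rewrite !mxE; congr (_ * _).
by rewrite [RHS](reindex_perm p); apply: eq_bigr => n _; rewrite ffunE.
Qed.

Let context_at_relabel (Pi : policy) C (X Y : nat -> @config S N) :
  (forall t, Y t = relabel (X t)) ->
  context_at Pi C Y =1 context_at Pi C X.
Proof. by move=> YX; elim=> //= t ->; rewrite !YX !empirical_relabel. Qed.

Let transition_prob_relabel a C (x y : @config S N) :
  transition_prob a C (relabel x) (relabel y) = transition_prob a C x y.
Proof.
rewrite /transition_prob [RHS](reindex_perm p).
by apply: eq_bigr => n _; rewrite !ffunE.
Qed.

Let relabel_inj : injective relabel.
Proof.
move=> x y /ffunP xy; apply/ffunP => n.
by have := xy (p^-1%g n); rewrite !ffunE permKV.
Qed.

Lemma config_value_relabel Pi (x : @config S N) C :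
  config_value Pi [ffun n => x (p n)] C = config_value Pi x C.
Proof.
pose h (w : trajectory N) : trajectory N := [ffun t => relabel (w t)].
have h_inj : injective h.
  move=> w w' /ffunP ww'; apply/ffunP => t; apply: relabel_inj.
  by have := ww' t; rewrite !ffunE.
rewrite /config_value (reindex_inj h_inj) /=; apply: eq_bigr => w _.
have hE t : position (h w) t = relabel (position w t).
  by rewrite /position ffunE.
have cE := @context_at_relabel Pi C _ _ hE.
congr (_ * _).
  congr (_ * _); first by rewrite hE (inj_eq relabel_inj).
  apply: eq_bigr => t _.
  by rewrite /action_at !hE !cE empirical_relabel transition_prob_relabel.
by apply: eq_bigr => t _; rewrite hE cE empirical_relabel.
Qed.

End Relabelling.

Lemma config_value_empirical N (Pi : policy) (x y : config N) (C : 'rV[R]_d) :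
  empirical x = empirical y :> 'rV[R]_S ->
  config_value Pi x C = config_value Pi y C.
Proof.
move=> xy.
have /tuple_permP[p xyp] :
    perm_eq [tuple x n | n < N.+1] [tuple y n | n < N.+1].
  apply/allP => i _ /=; apply/eqP.
  have countE (z : config N) : (count_mem i [tuple z n | n < N.+1])%:R
      = N.+1%:R * (@empirical R S N z) ord0 i.
    rewrite mxE mulrA divff ?mul1r ?pnatr_eq0// -natr_sum; congr (_%:R).
    by rewrite /= -sum1_count big_map big_enum_cond /= [LHS]big_mkcond.
  by apply/eqP; rewrite -(eqr_nat R) !countE xy.
have -> : x = [ffun n => y (p n)].
  apply/ffunP => n; rewrite ffunE.
  have := congr1 (fun s => nth (x n) s n) xyp.
  rewrite -[LHS]tnth_nth tnth_mktuple => ->.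
  by rewrite -[LHS]tnth_nth tnth_mktuple tnth_mktuple.
exact: config_value_relabel.
Qed.

End ControlledSystem.

Section Law.
Context {R : realType} {S d : nat} {A : metricType R}.
Variable m : model S d A.

Let transition_prob_sum1 N a C (x : @config S N) :
  \sum_y transition_prob m a C x y = 1.
Proof.
rewrite /transition_prob.
rewrite -(bigA_distr_bigA (fun n j => transition_matrix m a C (x n) j)) /=.
by rewrite big1 // => n _; case: (transition_matrix_stochastic m a C).
Qed.

Let context_at_eq N Pi C (X Y : nat -> @config S N) t :
  (forall u, (u <= t)%N -> X u = Y u) ->
  context_at m Pi C X t = context_at m Pi C Y t.
Proof.
elim: t => //= t IH XY; rewrite IH => [|u ut]; last by rewrite XY // leqW.
by rewrite !XY.
Qed.

Lemma trajectory_prob_ge0 T N Pi (x : @config S N) C (w : trajectory T N) :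
  0 <= trajectory_prob m Pi x C w.
Proof.
apply: mulr_ge0 => //; apply: prodr_ge0 => t _; apply: prodr_ge0 => n _.
by case: (transition_matrix_stochastic m (action_at m Pi C (position w) t)
            (context_at m Pi C (position w) t)).
Qed.

Lemma trajectory_prob_sum1 T N Pi (x : @config S N) C :
  \sum_(w : trajectory T N) trajectory_prob m Pi x C w = 1.
Proof.
elim: T => [|T IH].
  rewrite (bigD1 [ffun=> x]) //= big1 ?addr0 => [|w wx].
    by rewrite /trajectory_prob /position ffunE eqxx mul1r big_ord0.
  rewrite /trajectory_prob /position [w _ == x](_ : _ = false) ?mul0r //.
  apply: contraNF wx => /eqP <-; apply/eqP/ffunP => t.
  by rewrite ffunE !ord1.
pose ext (q : trajectory T N * @config S N) : trajectory T.+1 N :=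
  [ffun t : 'I_T.+2 => if (t <= T)%N then q.1 (inord t) else q.2].
pose res (w : trajectory T.+1 N) : trajectory T N * @config S N :=
  ([ffun t : 'I_T.+1 => w (inord t)], w ord_max).
have extK : cancel ext res.
  case=> w y; rewrite /res /ext; congr pair => /=.
    apply/ffunP => t; rewrite !ffunE inordK ?(leq_trans (ltn_ord t)) //=.
    by rewrite -ltnS ltn_ord inord_val.
  by rewrite ffunE ltnn.
have resK : cancel res ext.
  move=> w; apply/ffunP => t; rewrite !ffunE /=.
  case: leqP => tT; last first.
    by congr (w _); apply/val_inj/eqP; rewrite eqn_leq /= tT -ltnS ltn_ord.
  by rewrite inordK // inord_val.
rewrite (reindex ext) /=; last by exists res => q _.
rewrite -(pair_bigA _ (fun w y => trajectory_prob m Pi x C (ext (w, y)))) /=.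
rewrite -[RHS]IH; apply: eq_bigr => w _.
have posE y t : (t <= T)%N -> position (ext (w, y)) t = position w t.
  by move=> tT; rewrite /position ffunE inordK ?tT // ltnS leqW.
have posS y : position (ext (w, y)) T.+1 = y.
  by rewrite /position ffunE inordK // ltnn.
have ctxE y t : (t <= T)%N -> context_at m Pi C (position (ext (w, y))) t
                          = context_at m Pi C (position w) t.
  by move=> tT; apply: context_at_eq => u ut; rewrite posE // (leq_trans ut).
have actE y t : (t <= T)%N -> action_at m Pi C (position (ext (w, y))) t
                          = action_at m Pi C (position w) t.
  by move=> tT; rewrite /action_at posE // ctxE.
rewrite /trajectory_prob.
under eq_bigr => y _.
  rewrite big_ord_recr /= posS posE // posE // ctxE // actE // mulrA.
  rewrite (eq_bigr (fun t : 'I_T => transition_prob m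
     (action_at m Pi C (position w) t) (context_at m Pi C (position w) t)
     (position w t) (position w t.+1))) => [|t _]; last first.
    by rewrite actE ?ctxE ?posE // ltnW.
  over.
by rewrite -mulr_sumr transition_prob_sum1 mulr1.
Qed.

End Law.

(* Main.v *)
Require Import Defs.
From HB Require Import structures.
From mathcomp Require Import all_boot all_order all_algebra.
From mathcomp Require Import all_classical all_reals all_analysis.
From mathcomp Require Import lra.
Import Order.TTheory GRing.Theory Num.Theory.
Import numFieldTopology.Exports.

Local Open Scope classical_set_scope.
Local Open Scope ring_scope.

(* Given the actions, one step of the N-particle system moves the empirical
   measure M to M K(a, C) up to an error whose second moment is O(1/N), the
   particles being independent.  Contexts reachable in bounded time stay in
   compact sets, so all the maps involved are uniformly continuous there and,
   uniformly in the actions, a trajectory with small errors stays close to the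
   limit trajectory driven by the same actions.  Hence, uniformly in the policy,
   its value is, up to o(1), an average of values v_a(m0, c0) over the random
   action sequences a that it produces: it is at most v* + o(1), with equality
   for the constant policy a*. *)

(** * Uniform continuity on compact sets, and the compact simplex *)

Section Topology.
Import numFieldNormedType.Exports.

(** Heine-Cantor for a map controlled on [D] only: every point of [D] has a ball on which a single
    radius works, and compactness of [D], read as near covering, makes the radius uniform. *)
Lemma compact_unif_within {R : realType} {X Y : pseudoMetricType R}
    (D : set X) (f : X -> Y) : compact D -> {within D, continuous f} ->
  forall e : R, 0 < e -> \forall r \near 0^'+,
    forall x y, D x -> D y -> ball x r y -> ball (f x) e (f y).
Proof.
move=> /compact_near_coveringP/near_covering_withinP cD /subspace_continuousP cf.
move=> e e0.
pose P (r : R) (x : X) := forall y, D y -> ball x r y -> ball (f x) e (f y).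
suff: \forall r \near 0^'+, D `<=` P r.
  by apply: filterS => r H x y Dx Dy; apply: H.
apply: cD => x Dx.
have := cf x Dx; move/cvg_ballP => /(_ (e / 2)).
rewrite divr_gt0// => /(_ isT); rewrite near_withinE => /nbhs_ballP[q /= q0 H].
(* With [x'] within [q / 2] of [x] and [y] within [r < q / 2] of [x'], both lie within [q] of [x],
   so both images are [e / 2]-close to [f x]. *)
exists (ball x (q / 2), [set r | r < q / 2]) => /=.
  split; first by apply/nbhs_ballP; exists (q / 2) => //=; rewrite divr_gt0.
  by apply: nbhs_right_lt; rewrite divr_gt0.
move=> [x' r] /= [xx' rq] Dx' y Dy x'y.
apply: (@ball_splitr _ _ (f x)).
  apply: H => //; apply: le_ball xx'.
  by rewrite ler_pdivrMr// ler_peMr ?ltW// ltr1n.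
apply: H => //; apply: (ball_split xx').
by apply: le_ball x'y; exact: ltW.
Qed.

Lemma compact_box {R : realType} {n : nat} (lo hi : 'rV[R]_n) :
  compact [set v : 'rV[R]_n | forall i, v ord0 i \in `[lo ord0 i, hi ord0 i]].
Proof.
exact: (@rV_compact R n (fun i => `[lo ord0 i, hi ord0 i]%classic)
  (fun i => @segment_compact _ _ _)).
Qed.

(** The simplex is cut out of the unit box by closed half-spaces and a closed hyperplane; an entry
    is at most the total mass 1. *)
Lemma compact_distributions (R : realType) (S : nat) :
  compact (@distributions R S).
Proof.
have csum : continuous (fun p : 'rV[R]_S => \sum_i p ord0 i).
  apply: continuous_big => [|i _]; first exact: add_continuous.
  exact: coord_continuous.
apply: subclosed_compact (compact_box 0 (const_mx 1)) _.
- rewrite (_ : distributions =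
      \bigcap_(i in [set: 'I_S]) [set p | 0 <= p ord0 i]
      `&` [set p | \sum_i p ord0 i = 1]); last first.
    apply/seteqP; split => p [p0 p1]; split=> //; first by move=> i _; exact: p0.
    by move=> i; exact: p0.
  apply: closedI.
    apply: closed_bigI => i _.
    apply: (@preimage_closed _ _ (fun p : 'rV[R]_S => p ord0 i) [set x | 0 <= x]).
      by move=> p _; exact: coord_continuous.
    exact: closed_ge.
  apply: (@preimage_closed _ _ (fun p : 'rV[R]_S => \sum_i p ord0 i) [set x | x = 1]).
    by move=> p _; exact: csum.
  exact: closed_eq.
- move=> p [p0 p1] i /=; rewrite !mxE in_itv/= p0/= -p1 (bigD1 i)//= lerDl.
  exact: sumr_ge0.
Qed.

Lemma distributions_mulmx {R : realType} {S : nat} (p : 'rV[R]_S) (K : 'M[R]_S) :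
  distributions p -> stochastic_matrix K -> distributions (p *m K).
Proof.
move=> [p0 p1] [K0 K1]; split=> [j|].
  by rewrite mxE; apply: sumr_ge0 => i _; apply: mulr_ge0.
under eq_bigr do rewrite mxE.
rewrite exchange_big /= -[RHS]p1; apply: eq_bigr => i _.
by rewrite -mulr_sumr K1 mulr1.
Qed.

Lemma continuous_mulmx {R : realType} {X : topologicalType} {n : nat}
    (f : X -> 'rV[R]_n) (K : X -> 'M[R]_n) :
  continuous f -> continuous K -> continuous (fun x => f x *m K x).
Proof.
move=> cf cK x; apply/cvg_ballP => e e0.
suff : \forall y \near x, forall ij : 'I_1 * 'I_n,
    ball ((f x *m K x) ij.1 ij.2) e ((f y *m K y) ij.1 ij.2).
  by apply: filterS => y H; split => // i j; exact: (H (i, j)).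
apply: filter_forall => -[i j] /=.
have cs : continuous (fun y => (f y *m K y) i j).
  rewrite (_ : (fun y => _) = (fun y => \sum_k f y i k * K y k j)); last first.
    by apply/funext => y; rewrite mxE.
  apply: continuous_big => [|k _ y]; first exact: add_continuous.
  apply: cvgM.
    apply: (@continuous_comp _ _ _ f (fun M => M i k)); first exact: cf.
    exact: coord_continuous.
  apply: (@continuous_comp _ _ _ K (fun M => M k j)); first exact: cK.
  exact: coord_continuous.
by have /cvg_ballP := cs x; apply.
Qed.

End Topology.

(** * Stability of the limit flow under small errors in the kernel steps *)

Section Stability.
Context {R : realType} {S d : nat} {A : metricType R}.
Variables (m : model S d A) (T : nat).
Hypothesis compactA : compact [set: A].
Hypothesis kernel_cont :
  continuous (fun p : 'rV[R]_d * A => transition_matrix m p.2 p.1).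
Hypothesis context_cont :
  {within [set p : 'rV[R]_d * 'rV[R]_S * A | distributions p.1.2],
    continuous (fun p => next_context m p.1.1 p.1.2 p.2)}.
Hypothesis reward_cont : forall t, (1 <= t <= T)%N ->
  {within [set p : 'rV[R]_S * 'rV[R]_d | distributions p.1],
    continuous (fun p => mf_reward m t p.1 p.2)}.
Variables (m0 : 'rV[R]_S) (c0 : 'rV[R]_d).
Hypothesis m0_distr : distributions m0.

(** A compact set holding every context reachable at time [t] from the unit box around [c0],
    whatever the actions and the distributions met on the way. *)
Fixpoint context_range (t : nat) : set 'rV[R]_d :=
  if t is u.+1 then
    (fun p : 'rV[R]_d * 'rV[R]_S * A => next_context m p.1.1 p.1.2 p.2) @`
      (context_range u `*` distributions `*` [set: A])
  else [set C | forall i, C ord0 i \in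
    `[(c0 - const_mx 1) ord0 i, (c0 + const_mx 1) ord0 i]].

Lemma compact_context_range t : compact (context_range t).
Proof.
elim: t => [|t IH] /=; first exact: compact_box.
apply: continuous_compact.
  by apply: continuous_subspaceW context_cont => -[[C M] a] [[]].
apply: compact_setX => //; apply: compact_setX => //.
exact: compact_distributions.
Qed.

(** Common frame for the limit flow and for a particle trajectory: [M] may be any sequence of
    distributions, only the contexts obey a recursion. *)
Definition controlled (a : nat -> A) (M : nat -> 'rV[R]_S) (C : nat -> 'rV[R]_d) :=
  (forall t, distributions (M t)) /\
  (forall t, C t.+1 = next_context m (C t) (M t.+1) (a t)).

Definition close_to_kernel (r : R) (t : nat)
    (a : nat -> A) (M : nat -> 'rV[R]_S) (C : nat -> 'rV[R]_d) :=
  [/\ controlled a M C, ball m0 r (M 0%N), ball c0 r (C 0%N)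
    & forall u, (u < t)%N ->
        ball (M u *m transition_matrix m (a u) (C u)) r (M u.+1)].

Lemma context_range_controlled a M C t : context_range 0 (C 0%N) ->
  controlled a M C -> context_range t (C t).
Proof.
move=> C0 [Md CE]; elim: t => // t IH; rewrite CE /=.
exists (C t, M t.+1, a t) => //=; split=> //; split=> //; exact: Md.
Qed.

Lemma context_range_ball r C : r <= 1 -> ball c0 r C -> context_range 0 C.
Proof.
move=> r1 [_ c0C] i /=; rewrite in_itv /= !mxE.
have := c0C ord0 i; rewrite -ball_normE/= distrC ltr_distl => /andP[lo hi].
rewrite (le_trans _ (ltW lo)) ?(le_trans (ltW hi)) ?lerD2l ?lerN2//.
Qed.

Local Notation flow a t := (limit_flow m a (m0, c0) t).

Lemma limit_flow_controlled a :
  controlled a (fun t => (flow a t).1) (fun t => (flow a t).2).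
Proof.
split=> // -[|t] //=; last elim: t => [|t IH] /=; apply: distributions_mulmx => //;
  exact: transition_matrix_stochastic.
Qed.

Lemma limit_flow_context_range a t : context_range t (flow a t).2.
Proof.
apply: (@context_range_controlled a (fun u => (flow a u).1)
  (fun u => (flow a u).2)); last exact: limit_flow_controlled.
by apply: (@context_range_ball 1) => //=; exact: ballxx.
Qed.

(** The action ranges over a compact space and is the same on both sides, so [q] does not depend on
    it. *)
Lemma next_context_unif t (e : R) : 0 < e -> exists2 q : R, 0 < q &
  forall C M a C' M', context_range t C -> distributions M ->
    context_range t C' -> distributions M' -> ball C q C' -> ball M q M' ->
    ball (next_context m C M a) e (next_context m C' M' a).
Proof.
move=> e0.
have cD := compact_setX (compact_setX (compact_context_range t)
  (@compact_distributions R S)) compactA.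
have cg : {within context_range t `*` distributions `*` [set: A],
    continuous (fun p => next_context m p.1.1 p.1.2 p.2)}.
  by apply: continuous_subspaceW context_cont => -[[C M] a] [[]].
have [q [q0 H]] :=
  filter_ex (filterI (nbhs_right_gt 0) (compact_unif_within _ _ cD cg e e0)).
exists q => // C M a C' M' tC dM tC' dM' CC' MM'.
by apply: (H (C, M, a) (C', M', a)) => //; split => //=; exact: ballxx.
Qed.

Lemma kernel_step_unif t (e : R) : 0 < e -> exists2 q : R, 0 < q &
  forall C M a C' M', context_range t C -> distributions M ->
    context_range t C' -> distributions M' -> ball C q C' -> ball M q M' ->
    ball (M *m transition_matrix m a C) e (M' *m transition_matrix m a C').
Proof.
move=> e0.
have cD := compact_setX (compact_setX (compact_context_range t)
  (@compact_distributions R S)) compactA.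
pose f (p : 'rV[R]_d * 'rV[R]_S * A) := p.1.2 *m transition_matrix m p.2 p.1.1.
have cf : {within context_range t `*` distributions `*` [set: A], continuous f}.
  apply: continuous_subspaceT; apply: continuous_mulmx => p.
    by apply: continuous_comp; [exact: cvg_fst|exact: cvg_snd].
  apply: (@continuous_comp _ _ _ (fun p => (p.1.1, p.2))
    (fun p : 'rV[R]_d * A => transition_matrix m p.2 p.1)).
    apply: (@cvg_pair _ _ _ (nbhs p) (nbhs p.1.1) (nbhs p.2)
      (nbhs_filter _) _ _ (fun p => p.1.1) (fun p => p.2)); last exact: cvg_snd.
    by apply: continuous_comp; [exact: cvg_fst|exact: cvg_fst].
  exact: kernel_cont.
have [q [q0 H]] :=
  filter_ex (filterI (nbhs_right_gt 0) (compact_unif_within _ _ cD cf e e0)).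
exists q => // C M a C' M' tC dM tC' dM' CC' MM'.
by apply: (H (C, M, a) (C', M', a)) => //; split => //=; exact: ballxx.
Qed.

(** Induction on [t]: uniform continuity carries the previous error through one step, which adds at
    most [r] of its own. The moduli depend on [t] and [e] only, so the threshold on [r] is uniform
    in the actions. *)
Lemma limit_flow_stable t (e : R) : 0 < e -> \forall r \near 0^'+,
  forall a M C, close_to_kernel r t a M C ->
    ball (flow a t) e (M t, C t).
Proof.
elim: t e => [|t IH] e e0.
  near=> r => a M C [_ M0 C0 _].
  have re : r <= e by near: r; exact: nbhs_right_le.
  by split => /=; [exact: le_ball M0|exact: le_ball C0].
have [q q0 Hq] := next_context_unif t _ e0.
(* The context update reads the new distribution, which must therefore be within [q] as well as
   within [e]. One half of [e'] pays for moving the kernel step from the flow to the trajectory, the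
   other for the error [r]. *)
pose e' := Num.min e q.
have e'0 : 0 < e' / 2 by rewrite divr_gt0// lt_min e0.
have [q' q'0 Hq'] := kernel_step_unif t _ e'0.
near=> r => a M C [ctl M0 C0 Mu].
have r1 : r <= 1 by near: r; exact: nbhs_right_le.
have re' : r <= e' / 2 by near: r; exact: nbhs_right_le.
have [fM fC] : ball (flow a t) (Num.min q' q) (M t, C t).
  have close : close_to_kernel r t a M C.
    by split=> // u ut; apply: Mu; exact: ltnW.
  (* The trajectory is generalized before [r] is chosen, so that one [r] serves all trajectories. *)
  by move: a M C close {ctl M0 C0 Mu}; near: r; apply: IH; rewrite lt_min q'0.
have [flowd flowE] := limit_flow_controlled a.
have tf := limit_flow_context_range a t.
have tC := context_range_controlled _ _ _ t (context_range_ball _ _ r1 C0) ctl.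
have [Md CE] := ctl.
have MS : ball (flow a t.+1).1 e' (M t.+1).
  apply: (@ball_split _ _ (M t *m transition_matrix m (a t) (C t))).
    apply: Hq' => //.
      by apply: le_ball fC; rewrite ge_min lexx.
    by apply: le_ball fM; rewrite ge_min lexx.
  by apply: le_ball (Mu t _).
split; first by apply: le_ball MS; rewrite ge_min lexx.
rewrite flowE CE; apply: Hq => //.
- by apply: le_ball fC; rewrite ge_min lexx orbT.
- by apply: le_ball MS; rewrite ge_min lexx orbT.
Unshelve. all: by end_near. Qed.

Definition cumulated_reward (M : nat -> 'rV[R]_S) (C : nat -> 'rV[R]_d) :=
  \sum_(1 <= t < T.+1) mf_reward m t (M t) (C t).

Lemma limit_value_stable (e : R) : 0 < e -> \forall r \near 0^'+,
  forall a M C, close_to_kernel r T a M C ->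
    `|cumulated_reward M C - limit_value m T a (m0, c0)| <= e.
Proof.
move=> e0.
(* There are [T] rewards; the divisor [T.+1] is never zero and still gives a total of at most
   [e]. *)
have eT0 : 0 < e / T.+1%:R by rewrite divr_gt0.
(* Times form a finite type here, so the thresholds for the separate times can be intersected. *)
suff : \forall r \near 0^'+, forall (t : 'I_T.+1) a M C, (0 < t)%N ->
    close_to_kernel r T a M C ->
    `|mf_reward m t (M t) (C t)
      - mf_reward m t (flow a t).1 (flow a t).2| <= e / T.+1%:R.
  apply: filterS => r H a M C close.
  rewrite -sumrB (le_trans (ler_norm_sum _ _ _))//.
  apply: (@le_trans _ _ (\sum_(1 <= t < T.+1) (e / T.+1%:R))).
    rewrite big_nat_cond [leRHS]big_nat_cond.
    apply: ler_sum => t /andP[/andP[t0 tT] _].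
    exact: (H (Ordinal tT)).
  rewrite sumr_const_nat subn1 /= -[leLHS]mulr_natr -mulrA ler_piMr ?(ltW e0)//.
  by rewrite mulrC ler_pdivrMr// mul1r ler_nat.
apply: filter_forall => t.
have [t0|t0] := posnP t; first by near=> r => a M C; rewrite t0.
have tT : (1 <= t <= T)%N by rewrite t0 -ltnS ltn_ord.
have cD := compact_setX (@compact_distributions R S) (compact_context_range t).
have cr : {within distributions `*` context_range t,
    continuous (fun p => mf_reward m t p.1 p.2)}.
  by apply: continuous_subspaceW (reward_cont t tT) => -[M C] [].
have [q [q0 Hq]] :=
  filter_ex (filterI (nbhs_right_gt 0) (compact_unif_within _ _ cD cr _ eT0)).
near=> r => a M C _ close.
have [[Md CE] M0 C0 Mu] := close.
have r1 : r <= 1 by near: r; exact: nbhs_right_le.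
have [flowd _] := limit_flow_controlled a.
have fMC : ball (flow a t) q (M t, C t).
  have closet : close_to_kernel r t a M C.
    by split=> // u ut; apply: Mu; apply: leq_trans ut _; rewrite -ltnS.
  move: closet; move: (a) (M) (C); near: r; exact: limit_flow_stable.
rewrite distrC; apply: ltW.
apply: (Hq (flow a t) (M t, C t)) => //.
- split; [exact: flowd|exact: limit_flow_context_range].
- split => /=; [exact: Md|].
  apply: (@context_range_controlled a M) => //.
  exact: context_range_ball C0.
Unshelve. all: by end_near. Qed.

(** Continuous rewards are bounded on the compact sets of reachable states. This crude bound serves
    on the event where some step deviates, for the particles and for the limit flow alike. *)
Lemma cumulated_reward_bounded : exists B : R, forall a M C,
  context_range 0 (C 0%N) -> controlled a M C -> `|cumulated_reward M C| <= B.
Proof.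
have /choice[B HB] : forall t : nat, exists B : R, forall M C, (1 <= t <= T)%N ->
    distributions M -> context_range t C -> `|mf_reward m t M C| <= B.
  move=> t; have [tT|tT] := boolP (1 <= t <= T)%N; last by exists 0.
  have cr : {within distributions `*` context_range t,
      continuous (fun p => mf_reward m t p.1 p.2)}.
    by apply: continuous_subspaceW (reward_cont t tT) => -[M C] [].
  have /compact_bounded[B [_ HB]] := continuous_compact cr
    (compact_setX (@compact_distributions R S) (compact_context_range t)).
  exists (B + 1) => M C _ dM tC; apply: (HB (B + 1)); first by rewrite ltrDl.
  by exists (M, C).
exists (\sum_(1 <= t < T.+1) B t) => a M C C0 ctl.
have [Md _] := ctl.
rewrite (le_trans (ler_norm_sum _ _ _))//.
rewrite big_nat_cond [leRHS]big_nat_cond.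
apply: ler_sum => t /andP[tT _]; apply: HB => //.
exact: (@context_range_controlled a M).
Qed.

End Stability.

(** * Second moments under product laws, and the one-step deviation of the empirical measure *)

Section Product_law.
Context {R : realFieldType} {n : nat} {J : finType}.
Variables (q : 'I_n -> J -> R) (Z : 'I_n -> J -> R).
Hypothesis q1 : forall k, \sum_j q k j = 1.
Hypothesis qZ0 : forall k, \sum_j q k j * Z k j = 0.

(** Independence: once the integrand is a product over all coordinates, the sum over [y] factorizes.
    For distinct [k] and [l] the factor at [k] is the mean of a centred variable, hence zero. *)
Lemma product_law_cov k l :
  \sum_(y : {ffun 'I_n -> J}) (\prod_i q i (y i)) * (Z k (y k) * Z l (y l))
    = if k == l then \sum_j q k j * Z k j ^+ 2 else 0.
Proof.
(* Coordinates other than [k] and [l] get the factor 1; if [k = l] the two factors meet and give the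
   square. *)
pose f i j := (if i == k then Z k j else 1) * (if i == l then Z l j else 1).
have fE (y : {ffun 'I_n -> J}) :
    \prod_i f i (y i) = Z k (y k) * Z l (y l).
  by rewrite big_split /= -!big_mkcond /= !big_pred1_eq.
under eq_bigr do rewrite -fE -big_split /=.
rewrite -(bigA_distr_bigA (fun i j => q i j * f i j)) /= (bigD1 k) //=.
case: (eqVneq k l) => kl.
  rewrite [X in _ * X]big1 ?mulr1 => [|i /negbTE ik].
    by apply: eq_bigr => j _; rewrite /f -kl eqxx expr2.
  by rewrite -(q1 i); apply: eq_bigr => j _; rewrite /f -kl ik mul1r mulr1.
suff -> : \sum_j q k j * f k j = 0 by rewrite mul0r.
rewrite -[RHS](qZ0 k).
by apply: eq_bigr => j _; rewrite /f eqxx (negbTE kl) mulr1.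
Qed.

Lemma product_law_variance :
  \sum_(y : {ffun 'I_n -> J}) (\prod_i q i (y i)) * (\sum_i Z i (y i)) ^+ 2
    = \sum_i \sum_j q i j * Z i j ^+ 2.
Proof.
have squareE (y : {ffun 'I_n -> J}) : (\sum_i Z i (y i)) ^+ 2
    = \sum_k \sum_l Z k (y k) * Z l (y l).
  by rewrite expr2 mulr_suml; apply: eq_bigr => k _; rewrite mulr_sumr.
transitivity (\sum_(y : {ffun 'I_n -> J}) \sum_k \sum_l
    (\prod_i q i (y i)) * (Z k (y k) * Z l (y l))).
  apply: eq_bigr => y _; rewrite squareE mulr_sumr.
  by apply: eq_bigr => k _; rewrite mulr_sumr.
rewrite exchange_big /=; apply: eq_bigr => k _.
rewrite exchange_big /= (bigD1 k) //= product_law_cov eqxx.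
rewrite [X in _ + X]big1 ?addr0// => l.
by rewrite product_law_cov eq_sym => /negbTE ->.
Qed.

End Product_law.

(** The deviation is an average of [N.+1] independent centred variables bounded by 1: the variance
    of their sum is at most [N.+1], and averaging divides it by the square of [N.+1]. *)
Lemma empirical_deviation {R : realType} {S d : nat} {A : metricType R}
    (m : model S d A) N (a : A) (C : 'rV[R]_d) (x : @config S N) (j : 'I_S) :
  \sum_y transition_prob m a C x y *
    ((empirical y ord0 j - (empirical x *m transition_matrix m a C) ord0 j) ^+ 2)
  <= N.+1%:R^-1.
Proof.
have [K0 K1] := transition_matrix_stochastic m a C.
set K := transition_matrix m a C in K0 K1 *.
have K_le1 i : K i j <= 1 by rewrite -(K1 i) (bigD1 j)//= lerDl sumr_ge0.
(* The indicator that particle [n] lands in [j], minus its probability. *)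
pose Z (n : 'I_N.+1) (i : 'I_S) : R := (i == j)%:R - K (x n) j.
have ZE (y : @config S N) :
    empirical y ord0 j - (empirical x *m K) ord0 j
    = N.+1%:R^-1 * \sum_n Z n (y n).
  rewrite sumrB mulrBr !mxE; congr (_ - _).
  under eq_bigr do rewrite mxE -mulrA mulr_suml.
  rewrite -mulr_sumr exchange_big /=; congr (_ * _); apply: eq_bigr => n _.
  rewrite (bigD1 (x n)) //= eqxx mul1r big1 ?addr0 // => i.
  by rewrite eq_sym => /negbTE ->; rewrite mul0r.
under eq_bigr do rewrite ZE exprMn mulrCA.
rewrite -mulr_sumr (@product_law_variance _ _ _ (fun n i => K (x n) i)) //; last first.
  move=> n; under eq_bigr do rewrite mulrBr.
  rewrite sumrB -mulr_suml K1 mul1r (bigD1 j)//= eqxx mulr1 big1 ?addr0 ?subrr//.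
  by move=> i /negbTE ->; rewrite mulr0.
rewrite expr2 -mulrA ler_piMr ?invr_ge0// mulrC ler_pdivrMr ?ltr0n// mul1r.
have -> : N.+1%:R = \sum_(n < N.+1) (1 : R) by rewrite sumr_const card_ord.
rewrite ler_sum // => n _.
rewrite -[leRHS](K1 (x n)) ler_sum // => i _.
rewrite ler_piMr // -real_normK ?num_real// exprn_ile1// ler_norml /Z.
suff H (b : bool) (k : R) : 0 <= k -> k <= 1 -> -1 <= b%:R - k <= 1 by exact: H.
by case: b => k0 k1 /=; apply/andP; split; lra.
Qed.

(** * Splitting off the last step of a trajectory *)

Section Trajectories.
Context {R : realType} {S d : nat} {A : metricType R}.
Variable m : model S d A.

Lemma context_at_eq N Pi C (X Y : nat -> @config S N) t :
  (forall u, (u <= t)%N -> X u = Y u) ->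
  context_at m Pi C X t = context_at m Pi C Y t.
Proof.
elim: t => //= t IH XY; rewrite IH => [|u ut]; last by rewrite XY // leqW.
by rewrite !XY.
Qed.

Definition extend {T N} (w : trajectory T N) (y : @config S N) : trajectory T.+1 N :=
  [ffun t : 'I_T.+2 => if (t <= T)%N then w (inord t) else y].

Lemma position_extend T N (w : trajectory T N) (y : @config S N) t :
  (t <= T)%N -> position (extend w y) t = position w t.
Proof. by move=> tT; rewrite /position ffunE inordK ?tT // ltnS leqW. Qed.

Lemma position_extend_last T N (w : trajectory T N) (y : @config S N) :
  position (extend w y) T.+1 = y.
Proof. by rewrite /position ffunE inordK // ltnn. Qed.

Lemma sum_extend T N (G : trajectory T.+1 N -> R) :
  \sum_w G w = \sum_(w : trajectory T N) \sum_(y : @config S N) G (extend w y).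
Proof.
pose ext (q : trajectory T N * @config S N) := extend q.1 q.2.
pose res (w : trajectory T.+1 N) : trajectory T N * @config S N :=
  ([ffun t : 'I_T.+1 => position w t], position w T.+1).
have extK : cancel ext res.
  case=> w y; rewrite /res /ext position_extend_last; congr pair.
  apply/ffunP => t; rewrite ffunE position_extend -1?ltnS//.
  by rewrite /position inord_val.
have resK : cancel res ext.
  move=> w; apply/ffunP => t; rewrite !ffunE /=.
  case: leqP => tT; first by rewrite /position inordK// inord_val.
  by congr (w _); apply/val_inj/eqP; rewrite /= inordK// eqn_leq tT -ltnS ltn_ord.
rewrite (reindex ext) /=; last by exists res => q _.
by rewrite -(pair_bigA _ (fun w y => G (extend w y))).
Qed.

Lemma context_at_extend T N Pi C (w : trajectory T N) (y : @config S N) t :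
  (t <= T)%N -> context_at m Pi C (position (extend w y)) t
                = context_at m Pi C (position w) t.
Proof.
move=> tT; apply: context_at_eq => u ut.
by rewrite position_extend// (leq_trans ut).
Qed.

Lemma action_at_extend T N Pi C (w : trajectory T N) (y : @config S N) t :
  (t <= T)%N -> action_at m Pi C (position (extend w y)) t
                = action_at m Pi C (position w) t.
Proof. by move=> tT; rewrite /action_at position_extend// context_at_extend. Qed.

(** Contexts and actions up to time [T] depend only on positions up to [T], so the last step
    contributes one factor, its law given the past. *)
Lemma trajectory_prob_extend T N Pi x C (w : trajectory T N) (y : @config S N) :
  trajectory_prob m Pi x C (extend w y) = trajectory_prob m Pi x C w *
    transition_prob m (action_at m Pi C (position w) T)
      (context_at m Pi C (position w) T) (position w T) y.
Proof.
rewrite /trajectory_prob big_ord_recr /= position_extend_last !position_extend//.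
rewrite context_at_extend// action_at_extend// mulrA; congr (_ * _ * _).
apply: eq_bigr => t _.
by rewrite action_at_extend ?context_at_extend ?position_extend // ltnW.
Qed.

Lemma transition_prob_sum1 N a C (x : @config S N) :
  \sum_y transition_prob m a C x y = 1.
Proof.
rewrite -(bigA_distr_bigA (fun n j => transition_matrix m a C (x n) j)) /=.
by rewrite big1 // => n _; case: (transition_matrix_stochastic m a C).
Qed.

(** Tower property: the last increment is integrated first, given the past. As [b] bounds its
    conditional mean for every action, context and configuration, the result is uniform in the
    policy. *)
Lemma expected_sum_le N (h : A -> 'rV[R]_d -> @config S N -> config N -> R) (b : R) :
  (forall a C x, \sum_y transition_prob m a C x y * h a C x y <= b) ->
  forall T Pi x C, \sum_(w : trajectory T N) trajectory_prob m Pi x C w *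
    (\sum_(t < T) h (action_at m Pi C (position w) t)
       (context_at m Pi C (position w) t) (position w t) (position w t.+1))
  <= b *+ T.
Proof.
move=> hb T Pi x C; elim: T => [|T IH].
  by rewrite mulr0n big1// => w _; rewrite big_ord0 mulr0.
rewrite sum_extend mulrSr.
apply: (@le_trans _ _ (\sum_(w : trajectory T N) (trajectory_prob m Pi x C w *
    (\sum_(t < T) h (action_at m Pi C (position w) t)
       (context_at m Pi C (position w) t) (position w t) (position w t.+1))
    + trajectory_prob m Pi x C w * b))); last first.
  by rewrite big_split /= -mulr_suml trajectory_prob_sum1 mul1r lerD2r.
apply: ler_sum => w _; rewrite -mulrDr.
under eq_bigr => y _.
  rewrite trajectory_prob_extend big_ord_recr /= position_extend_last.
  rewrite position_extend// context_at_extend// action_at_extend//.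
  rewrite (eq_bigr (fun t : 'I_T => h (action_at m Pi C (position w) t)
     (context_at m Pi C (position w) t)
     (position w t) (position w t.+1))) => [|t _]; last first.
    by rewrite action_at_extend ?context_at_extend ?position_extend // ltnW.
  rewrite -mulrA mulrDr.
  over.
rewrite -mulr_sumr ler_wpM2l ?trajectory_prob_ge0// big_split /=.
by rewrite -mulr_suml transition_prob_sum1 mul1r lerD2l.
Qed.

End Trajectories.

(** * Values of the particle system compared with limit values *)

Section Values.
Context {R : realType} {S d : nat} {A : metricType R}.
Variables (m : model S d A) (T : nat).
Hypothesis compactA : compact [set: A].
Hypothesis kernel_cont :
  continuous (fun p : 'rV[R]_d * A => transition_matrix m p.2 p.1).
Hypothesis context_cont :
  {within [set p : 'rV[R]_d * 'rV[R]_S * A | distributions p.1.2],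
    continuous (fun p => next_context m p.1.1 p.1.2 p.2)}.
Hypothesis reward_cont : forall t, (1 <= t <= T)%N ->
  {within [set p : 'rV[R]_S * 'rV[R]_d | distributions p.1],
    continuous (fun p => mf_reward m t p.1 p.2)}.
Variables (m0 : 'rV[R]_S) (c0 : 'rV[R]_d).
Hypothesis m0_distr : distributions m0.

Definition squared_deviation N (a : A) (C : 'rV[R]_d) (x y : @config S N) : R :=
  \sum_j (empirical y ord0 j - (empirical x *m transition_matrix m a C) ord0 j) ^+ 2.

Lemma squared_deviation_ge0 N a C (x y : @config S N) :
  0 <= squared_deviation N a C x y.
Proof. by apply: sumr_ge0 => j _; exact: sqr_ge0. Qed.

Lemma expected_squared_deviation N a C (x : @config S N) :
  \sum_y transition_prob m a C x y * squared_deviation N a C x y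
  <= S%:R / N.+1%:R.
Proof.
under eq_bigr do rewrite mulr_sumr.
rewrite exchange_big /= mulr_natl -[S in leRHS]card_ord -sumr_const.
by apply: ler_sum => j _; exact: empirical_deviation.
Qed.

Lemma trajectory_controlled N Pi C (X : nat -> @config S N) :
  controlled m (action_at m Pi C X) (fun t => empirical (X t))
    (context_at m Pi C X).
Proof. by split=> // t; case: (@empirical_grid R S N (X t)). Qed.

(** The alternative behind Chebyshev: a step that is not [r]-close has an entry off by at least [r],
    and its square is one of the nonnegative terms of the sum. *)
Lemma close_to_kernel_or_deviates N Pi C (X : nat -> @config S N) (r : R) : 0 < r ->
  ball m0 r (empirical (X 0%N)) -> ball c0 r C ->
  close_to_kernel m m0 c0 r T (action_at m Pi C X) (fun t => empirical (X t))
    (context_at m Pi C X) \/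
  r ^+ 2 <= \sum_(t < T) squared_deviation N (action_at m Pi C X t)
    (context_at m Pi C X t) (X t) (X t.+1).
Proof.
move=> r0 X0 C0.
have [H|H] := pselect (forall u, (u < T)%N -> ball (empirical (X u)
    *m transition_matrix m (action_at m Pi C X u) (context_at m Pi C X u)) r
    (empirical (X u.+1))).
  by left; split=> //; exact: trajectory_controlled.
right; move/existsNP: H => [u /not_implyP[uT]] H.
apply: (@le_trans _ _ (squared_deviation N (action_at m Pi C X u)
    (context_at m Pi C X u) (X u) (X u.+1))); last first.
  rewrite (bigD1 (Ordinal uT)) //= lerDl.
  by apply: sumr_ge0 => t _; exact: squared_deviation_ge0.
rewrite leNgt; apply/negP => dev; apply: H; split=> // i j.
rewrite (ord1 i) /ball /= distrC -(ltr_pXn2r (n := 2))//; last first.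
  by rewrite nnegrE ltW.
rewrite real_normK ?num_real//; apply: le_lt_trans dev.
rewrite /squared_deviation (bigD1 j)//= lerDl.
by apply: sumr_ge0 => k _; exact: sqr_ge0.
Qed.

(** The limit system starts from [(m0, c0)] but is driven by the feedback actions that the particles
    produce; only these are random. *)
Definition expected_limit_value N Pi (x : @config S N) C : R :=
  \sum_(w : trajectory T N) trajectory_prob m Pi x C w *
    limit_value m T (action_at m Pi C (position w)) (m0, c0).

(* Chebyshev: outside an event of probability O(1/N) every step of the particle
   system is r-close to the kernel, whence the rewards are e-close to those of
   the limit system driven by the same, random, actions; on that event the
   rewards are merely bounded. *)
Lemma config_value_close (e : R) : 0 < e ->
  exists r K : R, 0 < r /\
  forall N Pi (x : @config S N) C, ball m0 r (empirical x) -> ball c0 r C ->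
    `|config_value m T Pi x C - expected_limit_value N Pi x C|
      <= e + K / N.+1%:R.
Proof.
move=> e0.
have [B HB] := @cumulated_reward_bounded _ _ _ _ m T compactA context_cont
  reward_cont c0.
have [r [[r0 r1] Hr]] := filter_ex (filterI (filterI (nbhs_right_gt 0)
  (nbhs_right_le ltr01))
  (limit_value_stable _ _ compactA kernel_cont context_cont reward_cont
     _ c0 m0_distr _ e0)).
(* [2 * B] bounds the gap between the rewards, [r ^+ 2] is the Chebyshev threshold, and the expected
   squared deviations over [T] steps total at most [S * T / N.+1]. *)
exists r, (2 * B / r ^+ 2 * (S * T)%:R); split=> // N Pi x C xr Cr.
have C0 := context_range_ball m c0 r C r1 Cr.
have c00 := context_range_ball m c0 1 c0 (lexx _) (ballxx _ ltr01).
pose dev (w : trajectory T N) := \sum_(t < T)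
  squared_deviation N (action_at m Pi C (position w) t)
    (context_at m Pi C (position w) t) (position w t) (position w t.+1).
have dev0 w : 0 <= dev w by apply: sumr_ge0 => t _; exact: squared_deviation_ge0.
have B0 : 0 <= B.
  pose X (_ : nat) : config N := x.
  exact: le_trans (normr_ge0 _)
    (HB _ _ _ C0 (trajectory_controlled N Pi C X)).
have c_ge0 : 0 <= 2 * B / r ^+ 2.
  by apply: divr_ge0; [exact: mulr_ge0|exact: sqr_ge0].
rewrite /config_value /expected_limit_value -sumrB.
rewrite (le_trans (ler_norm_sum _ _ _))//.
apply: (@le_trans _ _ (\sum_(w : trajectory T N)
    trajectory_prob m Pi x C w * (e + 2 * B / r ^+ 2 * dev w))).
  apply: ler_sum => w _; rewrite -mulrBr normrM ger0_norm ?trajectory_prob_ge0//.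
  (* Trajectories that do not start at [x] have probability zero. *)
  have [wx|wx] := eqVneq (position w 0) x; last first.
    by rewrite /trajectory_prob (negbTE wx) !mul0r.
  rewrite ler_wpM2l ?trajectory_prob_ge0//.
  have w0 : ball m0 r (empirical (position w 0)) by rewrite wx.
  have [close|far] := close_to_kernel_or_deviates N Pi C (position w) r r0 w0 Cr.
    apply: (le_trans (Hr _ _ _ close)).
    by rewrite lerDl mulr_ge0.
  apply: (@le_trans _ _ (2 * B)).
    rewrite (le_trans (ler_normB _ _))// mulr2n mulrDl !mul1r lerD//.
      exact: HB C0 (trajectory_controlled N Pi C (position w)).
    exact: HB c00 (limit_flow_controlled m m0 c0 m0_distr _).
  rewrite -mulrA ler_wpDl ?(ltW e0)// ler_peMr ?mulr_ge0//.
  by rewrite mulrC ler_pdivlMr ?exprn_gt0// mul1r.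
under eq_bigr do rewrite mulrDr.
rewrite big_split /= -mulr_suml trajectory_prob_sum1 mul1r lerD2l.
under eq_bigr do rewrite mulrCA.
rewrite -mulr_sumr -[leRHS]mulrA ler_wpM2l//.
apply: le_trans (expected_sum_le m N (squared_deviation N) _
  (@expected_squared_deviation N) T Pi x C) _.
by rewrite -[leLHS]mulr_natr natrM mulrAC.
Qed.

(** An average of limit values is at most any common bound [v]; under a constant policy the actions
    are not random and the average is the limit value itself. *)
Lemma value_close (e : R) : 0 < e ->
  exists r K : R, 0 < r /\
  forall N M C, grid_distributions N.+1 M -> ball m0 r M -> ball c0 r C ->
    (forall Pi v, (forall a, limit_value m T a (m0, c0) <= v) ->
      value m T N Pi (M, C) <= v + (e + K / N.+1%:R)) /\
    (forall a, `|value m T N (constant_policy a) (M, C)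
       - limit_value m T a (m0, c0)| <= e + K / N.+1%:R).
Proof.
move=> /config_value_close[r [K [r0 H]]]; exists r, K; split=> // N M C gM mM cC.
have [x [xM valE]] : exists x : config N, empirical x = M /\
    forall Pi, value m T N Pi (M, C) = config_value m T Pi x C.
  (* The default 0 of [value] never occurs: a grid distribution is the empirical measure of some
     configuration. *)
  rewrite /value; case: pickP => [x /eqP xM|no]; first by exists x.
  by have [x xM] := grid_distributionsP gM; have := no x; rewrite xM eqxx.
rewrite -xM in mM; split=> [Pi v Hv|a].
  have := H N Pi x C mM cC; rewrite valE ler_distl => /andP[_].
  move=> /le_trans; apply; rewrite lerD2r.
  rewrite -[leRHS]mul1r -(@trajectory_prob_sum1 _ _ _ _ m T N Pi x C) mulr_suml.
  by apply: ler_sum => w _; rewrite ler_wpM2l ?trajectory_prob_ge0.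
have := H N (constant_policy a) x C mM cC; rewrite -valE.
suff -> : expected_limit_value N (constant_policy a) x C
  = limit_value m T a (m0, c0) by [].
rewrite -[RHS]mul1r.
rewrite -(@trajectory_prob_sum1 _ _ _ _ m T N (constant_policy a) x C).
by rewrite mulr_suml.
Qed.

End Values.

(** * Admissibility of constant policies, and the almost sure limits *)

Lemma constant_policy_admissible {R : realType} {S d : nat} {A : metricType R}
    (T N : nat) (a : nat -> A) : @admissible R S d A T N (constant_policy a).
Proof.
move=> t _ U _.
(* A constant map has full or empty preimages, so it remains to see that the domain itself is
   Borel. *)
rewrite (_ : _ @^-1` U = if a t \in U then setT else set0); last first.
  rewrite /constant_policy; apply/seteqP; split=> s /=.
    by move=> ?; rewrite ifT// inE.
  by case: ifPn => //; rewrite inE.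
case: ifP => _; last first.
  by rewrite setI0; exact: sigma_algebra0.
rewrite setIT.
(* There are finitely many configurations, hence finitely many grid distributions. *)
have cg : closed (@grid_distributions R S N.+1).
  rewrite (_ : grid_distributions _ = @empirical R S N @` setT).
    apply: (accessible_finite_set_closed.1 _).
      apply: hausdorff_accessible; exact: norm_hausdorff.
    by apply: finite_image; exact: finite_finset.
  apply/seteqP; split => [M /grid_distributionsP[x xM]|_ [x _ <-]].
    by exists x.
  exact: empirical_grid.
rewrite -[X in <<s _ >> X]setCK; apply: sigma_algebraC.
apply: sub_sigma_algebra; rewrite /= openC.
rewrite (_ : _ `*` _ = fst @^-1` grid_distributions N.+1).
  apply: preimage_closed cg => s _; exact: cvg_fst.
by apply/seteqP; split => [[M C] []//|[M C] ?]; split.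
Qed.

Theorem theorem3 (R : realType) (S d T : nat)
  (S_ge1 : (1 <= S)%N) (d_ge1 : (1 <= d)%N) (T_ge1 : (1 <= T)%N)
  (A : metricType R) (m : model S d A)
  (* A1 is built into transition_prob *)
  (A2 : compact [set: A])
  (A3_kernel :
    continuous (fun p : 'rV[R]_d * A => transition_matrix m p.2 p.1) /\
    forall C, unif_continuous (fun a => transition_matrix m a C))
  (A3_next_context :
    {within [set p : 'rV[R]_d * 'rV[R]_S * A | distributions p.1.2],
      continuous (fun p => next_context m p.1.1 p.1.2 p.2)} /\
    forall C M, distributions M -> unif_continuous (fun a => next_context m C M a))
  (A3_reward : forall t, (1 <= t <= T)%N ->
    {within [set p : 'rV[R]_S * 'rV[R]_d | distributions p.1],
      continuous (fun p => mf_reward m t p.1 p.2)})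
  (dO : measure_display) (Omega : measurableType dO) (P : probability Omega R)
  (M0 : nat -> Omega -> 'rV[R]_S) (C0 : nat -> Omega -> 'rV[R]_d)
  (M0_grid : forall N omega, grid_distributions N.+1 (M0 N omega))
  (M0_measurable : forall N (U : set 'rV[R]_S),
    <<s open >> U -> measurable (M0 N @^-1` U))
  (C0_measurable : forall N (U : set 'rV[R]_d),
    <<s open >> U -> measurable (C0 N @^-1` U))
  (m0 : 'rV[R]_S) (c0 : 'rV[R]_d) (m0_distr : distributions m0)
  (A4_cvg : {ae P, forall omega,
    (fun N => (M0 N omega, C0 N omega)) @ \oo --> (m0, c0)})
  (A4_bound : exists B : R,
    {ae P, forall omega, forall N, mx_norm (C0 N omega) <= B})
  (astar : nat -> A)
  (astar_opt : (limit_value m T astar (m0, c0))%:E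
               = limit_opt_value m T (m0, c0)) :
  {ae P, forall omega,
    ((fun N => opt_value m T N (M0 N omega, C0 N omega)) @ \oo
       --> limit_opt_value m T (m0, c0)) /\
    ((fun N => (value m T N (constant_policy astar)
                  (M0 N omega, C0 N omega))%:E) @ \oo
       --> limit_opt_value m T (m0, c0))}.
Proof.
case: A3_kernel => kernel_cont _; case: A3_next_context => context_cont _.
have le_opt a : limit_value m T a (m0, c0) <= limit_value m T astar (m0, c0).
  by rewrite -lee_fin astar_opt; apply: ereal_sup_ubound; exists a.
set v := limit_value m T astar (m0, c0) in le_opt.
(* From here on the sample is fixed and the argument is deterministic. *)
apply: filterS A4_cvg => omega cvg0.
have Mcvg : M0 N omega @[N --> \oo] --> m0.
  exact: (cvg_comp _ _ cvg0 (@cvg_fst _ _ _ _ _)).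
have Ccvg : C0 N omega @[N --> \oo] --> c0.
  exact: (cvg_comp _ _ cvg0 (@cvg_snd _ _ _ _ _)).
(* The quantifier over policies stands inside the eventuality, so the bound passes to the
   supremum. *)
have close (e : R) : 0 < e -> \forall N \near \oo,
    (forall Pi, value m T N Pi (M0 N omega, C0 N omega) <= v + e) /\
    `|value m T N (constant_policy astar) (M0 N omega, C0 N omega) - v| <= e.
  move=> e0; have e20 : 0 < e / 2 by rewrite divr_gt0.
  have [r [K [r0 H]]] := value_close m T A2 kernel_cont context_cont A3_reward
    m0 c0 m0_distr _ e20.
  have K0 : 0 < e / 2 / (`|K| + 1) by rewrite divr_gt0// ltr_wpDl.
  near=> N.
  have KN : e / 2 + K / N.+1%:R <= e.
    rewrite [leRHS](splitr e) lerD2l.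
    have N1 : N.+1%:R^-1 <= e / 2 / (`|K| + 1).
      apply: ltW; near: N; exact: (near_infty_natSinv_lt (PosNum K0)).
    move: N1; rewrite ler_pdivlMr ?ltr_wpDl// mulrC; apply: le_trans.
    by rewrite ler_wpM2r// (le_trans (ler_norm K))// lerDl.
  have MN : ball m0 r (M0 N omega).
    by near: N; exact: (cvg_ball Mcvg).
  have CN : ball c0 r (C0 N omega).
    by near: N; exact: (cvg_ball Ccvg).
  have [ub cst] := H N _ _ (M0_grid N omega) MN CN.
  split=> [Pi|]; last exact: le_trans (cst astar) KN.
  by apply: le_trans (ub Pi v le_opt) _; rewrite lerD2l.
rewrite -astar_opt; split.
  (* The lower bound is the value of the admissible constant policy [astar], the upper one holds for
     all policies at once. *)
  have opt_close (e : R) : 0 < e -> \forall N \near \oo,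
      ((v - e)%:E <= opt_value m T N (M0 N omega, C0 N omega) <= (v + e)%:E)%E.
    move=> /close; apply: filterS => N [ub].
    rewrite ler_distl => /andP[lo _]; apply/andP; split.
      apply: (@le_trans _ _ (value m T N (constant_policy astar)
        (M0 N omega, C0 N omega))%:E); first by rewrite lee_fin.
      apply: ereal_sup_ubound.
      by exists (constant_policy astar) => //; exact: constant_policy_admissible.
    by apply: ge_ereal_sup => _ [Pi _ <-]; rewrite lee_fin.
  (* The supremum is an extended real; being eventually within 1 of [v] it is finite, and the
     convergence becomes one of reals. *)
  apply/fine_cvgP; split.
    apply: filterS (opt_close 1 ltr01) => N /andP[lo hi].
    by rewrite fin_numE; apply/andP; split; apply/eqP => E;
      move: lo hi; rewrite E ?leeNy_eq ?leye_eq.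
  apply/cvgrPdist_le => e e0.
  apply: filterS (opt_close e e0) => N /=.
  case: opt_value => [x| |] /=; rewrite ?lee_fin ?leye_eq ?leeNy_eq ?andbF//.
  by rewrite ler_distlC.
apply: cvg_EFin; first by apply: nearW.
apply/cvgrPdist_le => e e0.
by apply: filterS (close e e0) => N [_]; rewrite distrC.
Unshelve. all: by end_near. Qed.
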